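(* Let $G$ be a graph on $n$ nodes, let $k \in \left\{\left\lfloor \frac{n-1}{2}\right\rfloor, \left\lfloor \frac{n-1}{2}\right\rfloor+1, \ldots, n-2\right\}$ be an integer, and let $\mathcal{L}$ be a left partial layout of $G$ with respect to bandwidth $k$. For each $0 \le j < n-k-1$ define \[A_j := \{v \in V(G) \setminus \operatorname{im}(\mathcal{L}) : \{\mathcal{L}(i), v\} \notin E(G) \text{ for all } 0 \le i \le j\}.\] Then there exists a right partial layout $\mathcal{R}$ of $G$ with respect to bandwidth $k$, compatible with $\mathcal{L}$, such that $(\mathcal{L}, \mathcal{R})$ is feasible with respect to bandwidth $k$ if and only if $|A_j| \ge n-k-j-1$ for all $0 \le j < n-k-1$.
   Context: Graphs are unweighted, undirected, finite, with no self-loops. A layout of a graph $G$ on $n$ nodes is a bijection $\pi : V(G) \to \{0,1,\ldots,n-1\}$; the layout bandwidth $\beta_\pi(G)$ is the minimum non-negative integer $k$ such that $|\pi(u)-\pi(v)| \le k$ for every edge $\{u,v\}$. For $\left\lfloor \frac{n-1}{2}\right\rfloor \le k \le n-2$: a left partial layout (w.r.t. bandwidth $k$) is an injective map $\mathcal{L} : \{0,1,\ldots,n-k-2\} \to V(G)$; a right partial layout (w.r.t. bandwidth $k$) is an injective map $\mathcal{R} : \{k+1,k+2,\ldots,n-1\} \to V(G)$. $\mathcal{L}$ and $\mathcal{R}$ are compatible if $\operatorname{im}(\mathcal{L}) \cap \operatorname{im}(\mathcal{R}) = \emptyset$, equivalently if there is a layout $\pi$ such that $\pi^{-1}$ agrees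 with $\mathcal{L}$ and with $\mathcal{R}$ on their domains (such $\pi$ is said to induce $\mathcal{L}$ and $\mathcal{R}$). A compatible pair $(\mathcal{L}, \mathcal{R})$ is feasible (w.r.t. bandwidth $k$) if $\beta_\pi(G) \le k$ for every layout $\pi$ inducing $\mathcal{L}$ and $\mathcal{R}$. *)

(* Defs.v *)
From mathcomp Require Import all_boot all_algebra.

Set Implicit Arguments.
Unset Strict Implicit.
Unset Printing Implicit Defensive.

Record sgraph := SGraph {
  vertex :> finType;
  edge : rel vertex;
  edge_sym : symmetric edge;
  edge_irrefl : irreflexive edge
}.

Record layout (G : sgraph) := Layout {
  layout_fun :> G -> 'I_#|G|;
  layout_bij : bijective layout_fun
}.

(* The distance `|a - b|%N on naturals is the absolute difference, taken in
   int; it is not truncated subtraction. *)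
Definition within_bandwidth (G : sgraph) (pi : layout G) (k : nat) : bool :=
  [forall u : G, forall v : G, edge u v ==> (`|pi u - pi v|%N <= k)].

Lemma within_bandwidth_ex (G : sgraph) (pi : layout G) :
  exists k, within_bandwidth pi k.
Proof.
exists (\max_(u : G) \max_(v : G) `|pi u - pi v|%N).
apply/forallP => u; apply/forallP => v; apply/implyP => _.
apply: leq_trans (leq_bigmax u).
exact: (leq_bigmax (F := fun w : G => `|pi u - pi w|%N) v).
Qed.

Definition bandwidth (G : sgraph) (pi : layout G) : nat :=
  ex_minn (within_bandwidth_ex pi).

(* {0, ..., n-k-2} and {k+1, ..., n-1} as subtypes of 'I_n, where n = #|G|.
   Subtraction is truncated, so these are only meant for k + 2 <= n. *)
Definition left_position (G : sgraph) (k : nat) : finType :=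
  {i : 'I_#|G| | i < #|G| - k - 1}.
Definition right_position (G : sgraph) (k : nat) : finType :=
  {i : 'I_#|G| | k < i}.

Record left_layout (G : sgraph) (k : nat) := LeftLayout {
  left_fun :> left_position G k -> G;
  left_inj : injective left_fun
}.

Record right_layout (G : sgraph) (k : nat) := RightLayout {
  right_fun :> right_position G k -> G;
  right_inj : injective right_fun
}.

Definition compatible (G : sgraph) (k : nat)
    (L : left_layout G k) (R : right_layout G k) : bool :=
  [disjoint codom L & codom R].

(* The inverse of pi agrees with L and with R on their domains. *)
Definition induces (G : sgraph) (k : nat) (pi : layout G)
    (L : left_layout G k) (R : right_layout G k) : Prop :=
  (forall i : left_position G k, pi (L i) = val i) /\
  (forall i : right_position G k, pi (R i) = val i).

(* Only meant for compatible pairs: for other pairs no layout induces L and R,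
   and the condition holds vacuously. *)
Definition feasible (G : sgraph) (k : nat)
    (L : left_layout G k) (R : right_layout G k) : Prop :=
  forall pi : layout G, induces pi L R -> bandwidth pi <= k.

(* The set A_j of the vertices outside im(L) adjacent to none of
   L(0), ..., L(j). *)
Definition available (G : sgraph) (k : nat) (L : left_layout G k) (j : nat) :
    {set G} :=
  [set v : G | (v \notin codom L) &&
    [forall i : left_position G k, (val i <= j) ==> ~~ edge (L i) v]].

(* Main.v *)
Require Import Defs.
From mathcomp Require Import all_boot all_algebra.
From mathcomp Require Import zify.

(** Two positions further than [k] apart are a left position [i] and a right
    position [k + 1 + q] with [i <= q]. Hence a compatible pair is feasible
    exactly when the vertex at each position [k + 1 + q] lies in [A_q]. Since
    [A_q] is contained in [A_j] for [j <= q], the [n - k - 1 - j] vertices at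
    the positions with [q >= j] all lie in [A_j], which gives necessity.
    Conversely, the cardinality conditions allow one to choose distinct
    representatives greedily, from the last [A_j] to the first. *)

(** Induction on the size of the complement of [S]: while some [x] lies outside [S], [h @: S] has
    fewer than [#|T'|] elements, so a fresh value is left for [x]. This serves to complete a pair of
    partial layouts to a layout. *)
Lemma extend_inj_bij {T T' : finType} {S : {set T}} {h : T -> T'} :
  #|T| = #|T'| -> {in S &, injective h} ->
  exists2 g : T -> T', bijective g & {in S, g =1 h}.
Proof.
move=> cardT; have [d] := ubnP #|~: S|; elim: d S h => // d IHd S h ltSd injh.
have [S0 | [x]] := set_0Vmem (~: S).
  exists h => //; apply: inj_card_bij; last by rewrite cardT.
  have inS z : z \in S by rewrite -[S]setCK S0 setC0 inE.
  by move=> y z; apply: injh.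
rewrite inE => xS.
have [y yS] : exists y, y \notin h @: S.
  apply/existsP; rewrite -negb_forall; apply/negP => /forallP allS.
  have hT : h @: S = setT by apply/setP => y; rewrite inE allS.
  have : #|S| < #|T|.
    rewrite -[#|T|]cardsT; apply: proper_card; apply/properP; split=> //.
    by exists x; rewrite ?inE.
  by rewrite -(card_in_imset injh) hT cardsT cardT ltnn.
pose h' z := if z == x then y else h z.
have h'S : {in S, h' =1 h}.
  by move=> z zS; rewrite /h'; case: eqP => // zx; rewrite -zx zS in xS.
have neqy z : z \in S -> h' z <> y.
  by move=> zS zy; move: yS; rewrite -zy h'S ?imset_f.
have h'x : h' x = y by rewrite /h' eqxx.
have [||g bijg gh'] := IHd (x |: S) h'.
- have : #|x |: S| = #|S|.+1 by rewrite cardsU1 xS.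
  by move: (cardsC S) (cardsC (x |: S)) ltSd; lia.
- move=> a b /setU1P[-> | aS] /setU1P[-> | bS] //; rewrite ?h'x.
  + by move/esym/(neqy _ bS).
  + by move/(neqy _ aS).
  + by rewrite !h'S //; apply: injh.
by exists g => // z zS; rewrite gh' ?h'S ?inE ?zS ?orbT.
Qed.

(** The shifted family [A 1, A 2, ...] satisfies the hypothesis for one index fewer. Its
    representatives number one less than the lower bound on [#|A 0|], so [A 0] contains an element
    not yet chosen. *)
Lemma distinct_representatives {T : finType} {A : nat -> {set T}} {m : nat} :
  (forall j, j < m -> m - j <= #|A j|) ->
  exists2 s : m.-tuple T, uniq s & forall j : 'I_m, tnth s j \in A j.
Proof.
elim: m A => [|m IHm] A cardA; first by exists [tuple] => // -[].
have [|s uniqs sA] := IHm (fun j => A j.+1).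
  by move=> j ltjm; rewrite -subSS; apply: cardA.
have [x] : exists x, x \in A 0 :\: [set y in s].
  apply/set0Pn; rewrite setD_eq0; apply/negP => /subset_leq_card.
  rewrite cardsE (card_uniqP uniqs) size_tuple.
  by rewrite leqNgt; move: (cardA 0 isT); rewrite subn0 => ->.
rewrite !inE => /andP[xs xA].
exists [tuple of x :: s] => /=; first by rewrite xs.
by move=> j; case: (unliftP ord0 j) => [i ->|->]; rewrite ?tnthS ?tnth0.
Qed.

Lemma bandwidth_leP {G : sgraph} { pi : layout G} {k : nat} :
  reflect (forall u v, edge u v -> `|pi u - pi v|%N <= k) (bandwidth pi <= k).
Proof.
rewrite /bandwidth; case: ex_minnP => b wb minb.
apply: (iffP idP) => [lebk u v uv | wk].
  by move/forallP/(_ u)/forallP/(_ v)/implyP/(_ uv): wb => /leq_trans; apply.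
by apply/minb/forallP => u; apply/forallP => v; apply/implyP/wk.
Qed.

(** The lower bound on [k] amounts to [#|G| - k - 1 <= k + 1], so the two ranges of positions do not
    overlap. *)
Lemma left_lt_right {G : sgraph} {k : nat} :
  (#|G| - 1)./2 <= k ->
  forall (i : left_position G k) (p : right_position G k), val i < val p.
Proof.
move=> k_ge [i ltik] [p ltkp]; have lemk : #|G| - k - 1 <= k.+1 by lia.
exact: leq_trans ltik (leq_trans lemk ltkp).
Qed.

(** Ensures that feasibility of a compatible pair is not vacuous. *)
Lemma compatible_induces {G : sgraph} {k : nat}
    {L : left_layout G k} {R : right_layout G k} :
  (#|G| - 1)./2 <= k -> compatible L R -> exists pi, induces pi L R.
Proof.
move=> k_ge compLR.
have LR i p : L i <> R p.
  move=> LRip; have /pred0P/(_ (L i)) := compLR.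
  by rewrite /= codom_f LRip codom_f.
pose posL (v : G) := [pick i : left_position G k | L i == v].
pose posR (v : G) := [pick p : right_position G k | R p == v].
pose S : {set G} := [set v | (v \in codom L) || (v \in codom R)].
(* The value [enum_rank v] is an arbitrary default outside [S], to be replaced when [h] is extended
   from [S] to a bijection. *)
pose h v := if posL v is Some i then val i else
            if posR v is Some p then val p else enum_rank v.
have hL i : h (L i) = val i.
  rewrite /h /posL; case: pickP => [j /eqP/left_inj -> // | /(_ i)].
  by rewrite eqxx.
have hR p : h (R p) = val p.
  rewrite /h /posL; case: pickP => [i /eqP/LR // | _].
  rewrite /posR; case: pickP => [j /eqP/right_inj -> // | /(_ p)].
  by rewrite eqxx.
have injh : {in S &, injective h}.
  move=> u v; rewrite !inE => /orP[] /codomP[i ->] /orP[] /codomP[j ->];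
    rewrite ?hL ?hR => eq_ij.
  - by rewrite (val_inj eq_ij).
  - by have := left_lt_right k_ge i j; rewrite eq_ij ltnn.
  - by have := left_lt_right k_ge j i; rewrite eq_ij ltnn.
  - by rewrite (val_inj eq_ij).
have [|pi bijpi piS] := extend_inj_bij _ injh; first by rewrite card_ord.
exists (Layout bijpi); split=> i /=; rewrite piS ?hL ?hR ?inE ?codom_f ?orbT //.
Qed.

Lemma feasibleP {G : sgraph} {k : nat}
    {L : left_layout G k} {R : right_layout G k} :
  (#|G| - 1)./2 <= k -> compatible L R ->
  feasible L R <-> (forall p, R p \in available L (val p - k.+1)).
Proof.
move=> k_ge compLR; split=> [feas p | RA pi [piL piR]].
  have [pi indpi] := compatible_induces k_ge compLR.
  have [piL piR] := indpi.
  rewrite inE (disjointFl compLR) ?codom_f //=.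
  apply/forallP => i; apply/implyP => leip; apply/negP => adj.
  have /bandwidth_leP/(_ _ _ adj) := feas _ indpi.
  rewrite piL piR; case: p leip {adj} => p /= ltkp; lia.
(* Since [pi v < #|G|], a gap larger than [k] forces [pi u] to be a left position and [pi v] a right
   one. Thus [u] and [v] are values of [L] and [R], and [RA] rules out the edge. *)
have far u v : edge u v -> ~ (pi u + k < pi v).
  move=> adj ltuv.
  have ltu : pi u < #|G| - k - 1 by move: (ltn_ord (pi v)); lia.
  have ltv : k < pi v by lia.
  pose i : left_position G k := Sub (pi u) ltu.
  pose p : right_position G k := Sub (pi v) ltv.
  have pi_inj := bij_inj (@layout_bij _ pi).
  have Li : L i = u by apply: pi_inj; rewrite piL.
  have Rp : R p = v by apply: pi_inj; rewrite piR.
  have := RA p; rewrite inE => /andP[_ /forallP/(_ i)/implyP].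
  by rewrite Li Rp adj /= => nadj; have /nadj : pi u <= pi v - k.+1 by lia.
apply/bandwidth_leP => u v adj.
have := far u v adj; have := far v u; rewrite edge_sym => /(_ adj); lia.
Qed.

Lemma available_antitone (G : sgraph) (k : nat) (L : left_layout G k) (i j : nat) :
  i <= j -> available L j \subset available L i.
Proof.
move=> leij; apply/subsetP => v; rewrite !inE => /andP[-> /forallP nadj].
apply/forallP => a; apply/implyP => leai.
by apply: (implyP (nadj a)); apply: leq_trans leij.
Qed.

Theorem theorem3p2 (G : sgraph) (k : nat)
    (k_ge : (#|G| - 1)./2 <= k) (k_le : k + 2 <= #|G|)
    (L : left_layout G k) :
  (exists R : right_layout G k, compatible L R /\ feasible L R) <->
  (forall j : nat, j < #|G| - k - 1 ->
     #|available L j| >= #|G| - k - j - 1).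
Proof.
split=> [[R [compLR /(feasibleP k_ge compLR) RA]] j ltj | cardA].
  (* The right positions from [k + 1 + j] on are indexed by [q]; [R] maps them injectively into
     [available L j]. *)
  have ltq (q : 'I_(#|G| - k - j - 1)) : k.+1 + j + q < #|G|.
    by move: (ltn_ord q); lia.
  have ltkq (q : 'I_(#|G| - k - j - 1)) : k < Ordinal (ltq q) by rewrite /=; lia.
  pose p q : right_position G k := Sub (Ordinal (ltq q)) (ltkq q).
  have injp : injective (fun q => R (p q)).
    move=> a b /right_inj /(congr1 (fun x => nat_of_ord (val x))) /= eqab.
    by apply: ord_inj; lia.
  rewrite -[X in X <= _]card_ord -(card_imset _ injp).
  apply/subset_leq_card/subsetP => _ /imsetP[q _ ->].
  by apply: (subsetP _ _ (RA (p q))); apply: available_antitone; rewrite /=; lia.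
have [|s uniqs sA] := @distinct_representatives _ (available L) (#|G| - k - 1).
  by move=> j ltj; rewrite subnAC; apply: cardA.
(* Position [p] receives the representative of index [p - (k + 1)]. As [k < p], the subtraction does
   not truncate, so distinct positions get distinct indices. *)
have ltp (p : right_position G k) : val p - k.+1 < #|G| - k - 1.
  case: p => p ltkp; rewrite -subnDA addn1.
  by apply: ltn_sub2r (ltn_ord p); apply: leq_ltn_trans (ltn_ord p).
pose r p := tnth s (Ordinal (ltp p)).
have injr : injective r.
  move=> p q; move/(tuple_uniqP _ uniqs)/(congr1 val) => /= eqpq.
  apply: val_inj; apply: ord_inj.
  by case: p q eqpq => p /= ltkp [q /= ltkq]; lia.
pose R := RightLayout injr.
have RA p : R p \in available L (val p - k.+1) by apply: sA.
have compLR : compatible L R.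
  rewrite /compatible disjoint_sym disjoint_subset; apply/subsetP => _ /codomP[p ->].
  by move: (RA p); rewrite !inE => /andP[].
by exists R; split=> //; apply/feasibleP.
Qed.
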